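(* Let $G$ be a group acting properly and by isometries on a metric space $X$, let $X/G$ carry the quotient metric, and let $t>0$. If the action is a $t$-nerve action, then (i) $\check{\mathrm{C}}_<(X/G;r)$ is isomorphic to $\check{\mathrm{C}}_<(X;r)/G$ for all $r\le t$; (ii) $\check{\mathrm{C}}_\le(X/G;r)$ is isomorphic to $\check{\mathrm{C}}_\le(X;r)/G$ for all $r<t$; (iii) $\check{\mathrm{C}}^m_<(X/G;r)$ is homeomorphic to $\check{\mathrm{C}}^m_<(X;r)/G$ for all $r\le t$; and (iv) $\check{\mathrm{C}}^m_\le(X/G;r)$ is homeomorphic to $\check{\mathrm{C}}^m_\le(X;r)/G$ for all $r<t$.
   Context: Scale parameters satisfy $r\ge 0$. For a metric space $Y$, $B_Y(y,r)=\{z\in Y : d(y,z)<r\}$ is the open ball and $B_{Y,\le}(y,r)=\{z\in Y : d(y,z)\le r\}$ the closed ball. Group actions. $G$ acts by isometries on $X$ if for each $g\in G$ the map $x\mapsto g\cdot x$ is an isometry of $X$. The action is proper if for each $x\in X$ there is some $\rho>0$ such that $\{g\in G : g\cdot B_X(x,\rho)\cap B_X(x,\rho)\ne\emptyset\}$ is finite. For $x\in X$, $[x]\in X/G$ denotes its orbit. If $G$ acts properly by isometries, $X/G$ is a metric space with the quotient metric $d_{X/G}([x],[x'])=\inf_{g\in G}d_X(x,g\cdot x')$. $t$-nerve action. For $t>0$, the action of $G$ on $X$ is a $t$-nerve action if for any nonnegative integer $k$ and $x_0,\dots,x_k\in X$, $\bigcap_{i=0}^k B_{X/G}([x_i],t)\ne\emptyset$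 implies that there exists a unique choice of elements $g_i\in G$ for $1\le i\le k$ such that $\bigcap_{i=0}^k B_X(g_i\cdot x_i,t)\neq\emptyset$, where $g_0$ is required to be the identity element of $G$. Čech complexes. For a metric space $Y$, $\check{\mathrm{C}}_<(Y;r)$ (resp. $\check{\mathrm{C}}_\le(Y;r)$) is the simplicial complex with vertex set $Y$ in which a finite set $\{y_0,\dots,y_k\}$ is a simplex if $\bigcap_{i=0}^k B_Y(y_i,r)\ne\emptyset$ (resp. $\bigcap_{i=0}^k B_{Y,\le}(y_i,r)\ne\emptyset$). Simplicial complexes are identified with their geometric realizations, whose points are written as convex combinations $\sum\lambda_i y_i$ of the vertices of a simplex. Metric thickenings. $\check{\mathrm{C}}^m_<(Y;r)$ (resp. $\check{\mathrm{C}}^m_\le(Y;r)$) is, as a set, the geometric realization of $\check{\mathrm{C}}_<(Y;r)$ (resp. $\check{\mathrm{C}}_\le(Y;r)$), where $\sum\lambda_i y_i$ is regarded as the finitely supported probability measure $\sum\lambda_i\delta_{y_i}$; it is equipped with the 1-Wasserstein metric. Induced actions. $G$ acts on each of these complexes and thickenings of $X$ by $g\cdot\sum\lambda_i x_i=\sum\lambda_i\,(g\cdot x_i)$. The notation $(-)/G$ means the orbit space of this action (with the quotient topology); in the case of simplicial complexes, the orbit space of the geometric realization carries the simplicial structure induced by the images of simplices, and ''isomorphic'' means isomorphic as simplicial complexes. *)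

(* Defs.v *)
From HB Require Import structures.
From mathcomp Require Import all_boot all_order all_algebra finmap generic_quotient.
From mathcomp Require Import all_classical all_reals all_analysis.

Set Implicit Arguments.
Unset Strict Implicit.
Unset Printing Implicit Defensive.

Import Order.TTheory GRing.Theory Num.Theory.

Local Open Scope classical_set_scope.
Local Open Scope ring_scope.

Section FinitelySupported.
Variable R : realType.

Local Notation fsf T := {fsfun T -> R with 0}.

Definition fsint (T : choiceType) (f : fsf T) (h : T -> R) : R :=
  \sum_(x <- finsupp f) f x * h x.

Lemma fsint_sub (T : choiceType) (f : fsf T) h (A : {fset T}) :
  {subset finsupp f <= A} -> fsint f h = \sum_(x <- A) f x * h x.
Proof.
move=> sA; apply: big_fset_incl => [|x xA xf]; first exact/fsubsetP.
by rewrite fsfun_dflt// mul0r.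
Qed.

Lemma eq_fsint (T : choiceType) (f : fsf T) (h k : T -> R) :
  {in finsupp f, h =1 k} -> fsint f h = fsint f k.
Proof. by move=> hk; apply: eq_big_seq => x xf; rewrite hk. Qed.

Lemma fsint_delta (T : choiceType) (f : fsf T) x :
  fsint f (fun y => (y == x)%:R) = f x.
Proof.
rewrite (@fsint_sub _ _ _ (x |` finsupp f)%fset); last first.
  by move=> y yf; rewrite !inE yf orbT.
rewrite (big_fsetD1 x) ?fset1U1//= eqxx mulr1 big1_seq ?addr0// => y.
by rewrite !inE => /andP[_ /andP[/negPf -> _]]; rewrite mulr0.
Qed.

Lemma fsintD (T : choiceType) (f : fsf T) h k :
  fsint f (fun x => h x + k x) = fsint f h + fsint f k.
Proof. by rewrite -big_split; apply: eq_bigr => x _; rewrite mulrDr. Qed.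

Lemma fsintZ (T : choiceType) (f : fsf T) c h :
  fsint f (fun x => c * h x) = c * fsint f h.
Proof. by rewrite mulr_sumr; apply: eq_bigr => x _; rewrite mulrCA. Qed.

Lemma ler_fsint (T : choiceType) (f : fsf T) h k : (forall x, 0 <= f x) ->
  {in finsupp f, forall x, h x <= k x} -> fsint f h <= fsint f k.
Proof.
move=> f0 hk; rewrite /fsint big_seq [leRHS]big_seq.
by apply: ler_sum => x xf; rewrite ler_wpM2l// hk.
Qed.

Lemma fsint_ge0 (T : choiceType) (f : fsf T) h : (forall x, 0 <= f x) ->
  (forall x, 0 <= h x) -> 0 <= fsint f h.
Proof. by move=> f0 h0; apply: sumr_ge0 => x _; rewrite mulr_ge0. Qed.

Lemma exchange_fsint (T U : choiceType) (f : fsf T) (k : fsf U) h :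
  fsint f (fun x => fsint k (h x)) = fsint k (fun y => fsint f (h ^~ y)).
Proof.
rewrite /fsint; under eq_bigr do rewrite mulr_sumr.
rewrite exchange_big; apply: eq_bigr => y _; rewrite mulr_sumr.
by apply: eq_bigr => x _; rewrite mulrCA.
Qed.

(* the image of the formal sum \sum_x f x * x under g *)
Definition push (T U : choiceType) (g : T -> U) (f : fsf T) : fsf U :=
  [fsfun u in (g @` finsupp f)%fset => \sum_(x <- finsupp f | g x == u) f x].

Lemma pushE (T U : choiceType) (g : T -> U) (f : fsf T) u :
  push g f u = fsint f (fun x => (g x == u)%:R).
Proof.
rewrite /push /fsint fsfunE; case: ifPn => [_|ugf].
  rewrite big_mkcond; apply: eq_bigr => x _.
  by case: eqP; rewrite ?mulr1 ?mulr0.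
rewrite big1_seq// => x /andP[_ xf]; case: eqP => [gxu|]; last by rewrite mulr0.
by case/negP: ugf; rewrite -gxu in_imfset.
Qed.

Lemma finsupp_push_sub (T U : choiceType) (g : T -> U) (f : fsf T) :
  {subset finsupp (push g f) <= (g @` finsupp f)%fset}.
Proof.
by apply/fsubsetP; apply: finsupp_sub.
Qed.

Lemma fsint_push (T U : choiceType) (g : T -> U) (f : fsf T) h :
  fsint (push g f) h = fsint f (h \o g).
Proof.
rewrite (fsint_sub _ (@finsupp_push_sub _ _ g f)).
under eq_bigr do rewrite pushE mulr_suml.
rewrite exchange_big; apply: eq_big_seq => x xf.
rewrite (big_fsetD1 (g x)) ?in_imfset//= eqxx mulr1 big1_seq ?addr0// => y.
by rewrite !inE eq_sym => /andP[_ /andP[/negPf -> _]]; rewrite mulr0 mul0r.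
Qed.

Lemma push_comp (T U W : choiceType) (g : U -> W) (h : T -> U) (f : fsf T) :
  push g (push h f) = push (g \o h) f.
Proof. by apply/fsfunP => w; rewrite pushE fsint_push pushE. Qed.

Lemma push_id (T : choiceType) (g : T -> T) (f : fsf T) : g =1 id -> push g f = f.
Proof.
move=> gid; apply/fsfunP => x; rewrite pushE -[RHS]fsint_delta.
by apply: eq_fsint => y _; rewrite gid.
Qed.

Lemma push_ge0 (T U : choiceType) (g : T -> U) (f : fsf T) :
  (forall x, 0 <= f x) -> forall u, 0 <= push g f u.
Proof. by move=> f0 u; rewrite pushE fsint_ge0. Qed.

Lemma finsupp_push (T U : choiceType) (g : T -> U) (f : fsf T) :
  (forall x, 0 <= f x) -> finsupp (push g f) = (g @` finsupp f)%fset.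
Proof.
move=> f0; apply/fsetP => u; apply/idP/idP; first exact: finsupp_push_sub.
move=> /imfsetP[x /= xf ->]; rewrite mem_finsupp pushE gt_eqF//.
rewrite /fsint (big_fsetD1 x)//= eqxx mulr1 ltr_wpDr//.
  by apply: sumr_ge0 => y _; rewrite mulr_ge0.
by rewrite lt_def f0 andbT -mem_finsupp.
Qed.

Lemma sum_push (T U : choiceType) (g : T -> U) (f : fsf T) :
  \sum_(u <- finsupp (push g f)) push g f u = \sum_(x <- finsupp f) f x.
Proof.
transitivity (fsint (push g f) (fun=> 1)).
  by apply: eq_bigr => u _; rewrite mulr1.
by rewrite fsint_push; apply: eq_bigr => x _; rewrite mulr1.
Qed.

Definition reweight (T : choiceType) (w : T -> R) (f : fsf T) : fsf T :=
  [fsfun x in finsupp f => w x * f x].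

Lemma reweightE (T : choiceType) (w : T -> R) (f : fsf T) x :
  reweight w f x = w x * f x.
Proof.
by rewrite fsfunE; case: ifPn => // xf; rewrite fsfun_dflt// mulr0.
Qed.

Lemma fsint_reweight (T : choiceType) (w : T -> R) (f : fsf T) h :
  fsint (reweight w f) h = fsint f (fun x => w x * h x).
Proof.
rewrite (@fsint_sub _ _ _ (finsupp f)).
  by apply: eq_bigr => x _; rewrite reweightE mulrCA mulrA.
by move=> x; rewrite !mem_finsupp reweightE mulf_eq0 negb_or => /andP[].
Qed.

Definition fsbind (T U : choiceType) (f : fsf T) (k : T -> fsf U) : fsf U :=
  [fsfun u in (\bigcup_(x <- finsupp f) finsupp (k x))%fset =>
     fsint f (fun x => k x u)].

Lemma fsbindE (T U : choiceType) (f : fsf T) (k : T -> fsf U) u :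
  fsbind f k u = fsint f (fun x => k x u).
Proof.
rewrite fsfunE; case: ifPn => // uk; rewrite /fsint big1_seq// => x /andP[_ xf].
rewrite [k x u]fsfun_dflt ?mulr0//; apply: contra uk => uk.
by apply/bigfcupP; exists x => //; rewrite xf.
Qed.

Lemma fsint_bind (T U : choiceType) (f : fsf T) (k : T -> fsf U) h :
  fsint (fsbind f k) h = fsint f (fun x => fsint (k x) h).
Proof.
set A := (\bigcup_(x <- finsupp f) finsupp (k x))%fset.
have sA : {subset finsupp (fsbind f k) <= A}.
  by apply/fsubsetP; apply: finsupp_sub.
rewrite (fsint_sub _ sA); under eq_bigr do rewrite fsbindE mulr_suml.
rewrite exchange_big; apply: eq_big_seq => x xf.
rewrite (@fsint_sub _ (k x) h A) ?mulr_sumr.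
  by apply: eq_bigr => u _; rewrite mulrA.
by move=> u uk; apply/bigfcupP; exists x => //; rewrite xf.
Qed.

End FinitelySupported.

Lemma mdist_separated (R : realType) (Y : metricType R) (x : Y) (A : seq Y) :
  exists2 e : R, 0 < e & forall y, y \in A -> y != x -> e <= mdist x y.
Proof.
elim: A => [|a A [e e0 eA]]; first by exists 1.
have [->|ax] := eqVneq a x.
  by exists e => // y; rewrite inE => /predU1P[->|/eA//]; rewrite eqxx.
exists (Num.min e (mdist x a)).
  by rewrite lt_min e0 mdist_gt0 eq_sym.
move=> y; rewrite inE ge_min => /predU1P[->|/eA eAy /eAy ->//].
by rewrite lexx orbT.
Qed.

Section Complexes.
Variable V : choiceType.

Record simplicial_complex := SimplicialComplex {
  simplices :> {fset V} -> Prop;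
  simplex_neq0 : forall S, simplices S -> S != fset0;
  simplex_sub : forall S T, (S `<=` T)%fset -> S != fset0 ->
    simplices T -> simplices S }.

End Complexes.

Section Realization.
Variables (R : realType) (V : choiceType) (K : simplicial_complex V).

Record realization := Realization {
  weight :> {fsfun V -> R with 0};
  weightP : `[< [/\ forall v, 0 <= weight v,
                \sum_(v <- finsupp weight) weight v = 1
              & K (finsupp weight)] >] }.

HB.instance Definition _ := [isSub for weight].
HB.instance Definition _ := [Choice of realization by <:].

Lemma weight_ge0 (p : realization) v : 0 <= p v.
Proof. by case: p => w /= /asboolP[]. Qed.

Lemma weight_sum1 (p : realization) : \sum_(v <- finsupp p) p v = 1.
Proof. by case: p => w /= /asboolP[]. Qed.

Lemma weight_simplex (p : realization) : K (finsupp p).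
Proof. by case: p => w /= /asboolP[]. Qed.

(* The weak topology: U is open iff its trace on each closed simplex S is open
   for the Euclidean topology of the barycentric coordinates indexed by S. *)
Definition weak_open (U : set realization) :=
  forall S, K S -> forall p, U p -> (finsupp p `<=` S)%fset ->
    exists2 e : R, 0 < e &
      forall q : realization, (finsupp q `<=` S)%fset ->
        (forall v, v \in S -> `|p v - q v| < e) -> U q.

Lemma weak_openT : weak_open setT.
Proof. by move=> S KS p _ _; exists 1. Qed.

Lemma weak_openI : setI_closed weak_open.
Proof.
move=> A B oA oB S KS p [Ap Bp] pS.
have [e e0 eA] := oA S KS p Ap pS; have [d d0 dB] := oB S KS p Bp pS.
exists (Num.min e d); first by rewrite lt_min e0 d0.
move=> q qS pq; split; [apply: eA => // v vS|apply: dB => // v vS].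
- by have := pq v vS; rewrite lt_min => /andP[].
- by have := pq v vS; rewrite lt_min => /andP[].
Qed.

Lemma weak_open_bigU (I : Type) (f : I -> set realization) :
  (forall i, weak_open (f i)) -> weak_open (\bigcup_i f i).
Proof.
move=> of_ S KS p [i _ fip] pS; have [e e0 ef] := of_ i S KS p fip pS.
by exists e => // q qS pq; exists i => //; exact: ef.
Qed.

HB.instance Definition _ := isOpenTopological.Build realization
  weak_openT weak_openI weak_open_bigU.

End Realization.

Section InducedMap.
Variables (R : realType) (V W : choiceType).
Variables (K : simplicial_complex V) (L : simplicial_complex W) (f : V -> W).
Hypothesis fKL : forall S, K S -> L (f @` S)%fset.

Fact induced_map_subproof (p : realization R K) :
  `[< [/\ forall w, 0 <= push f p w,
      \sum_(w <- finsupp (push f p)) push f p w = 1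
    & L (finsupp (push f p))] >].
Proof.
apply/asboolP; have p0 := weight_ge0 p; split; first exact: push_ge0.
  by rewrite sum_push weight_sum1.
by rewrite finsupp_push//; apply: fKL; exact: weight_simplex.
Qed.

Definition induced_map (p : realization R K) : realization R L :=
  Realization (induced_map_subproof p).

End InducedMap.

Section Thickening.
Variables (R : realType) (Y : metricType R) (K : simplicial_complex Y).

Definition thickening := realization R K.

HB.instance Definition _ := Choice.on thickening.

Implicit Types p q s : thickening.

(* Any coupling of two finitely supported measures is finitely supported. *)
Definition coupling p q : set {fsfun Y * Y -> R with 0} :=
  [set c : {fsfun Y * Y -> R with 0} | [/\ forall z, 0 <= c z, push fst c = weight p
                                 & push snd c = weight q]].

Definition transport_cost (c : {fsfun Y * Y -> R with 0}) : R :=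
  \sum_(z <- finsupp c) c z * mdist z.1 z.2.

Definition wasserstein p q : R := inf (transport_cost @` coupling p q).

Let costE c : transport_cost c = fsint c (fun z => mdist z.1 z.2).
Proof. by []. Qed.

Let cost_ge0 p q : lbound (transport_cost @` coupling p q) 0.
Proof.
move=> _ [c [c0 _ _] <-]; apply: sumr_ge0 => z _.
by rewrite mulr_ge0// mdist_ge0.
Qed.

Let fsint1 p : fsint p (fun=> 1) = 1.
Proof.
by rewrite -[RHS](weight_sum1 p); apply: eq_bigr => x _; rewrite mulr1.
Qed.

Let coupling_neq0 p q : coupling p q !=set0.
Proof.
exists (fsbind p (fun x => push (pair x) q)); split.
- move=> z; rewrite fsbindE fsint_ge0// => x; first exact: weight_ge0.
  by apply: push_ge0 => y; exact: weight_ge0.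
- apply/fsfunP => x; rewrite pushE fsint_bind -[RHS]fsint_delta.
  apply: eq_fsint => y _; rewrite fsint_push /=.
  rewrite -[RHS]mulr1 -(fsint1 q) -fsintZ.
  by apply: eq_fsint => z _ /=; rewrite mulr1.
- apply/fsfunP => x; rewrite pushE fsint_bind.
  transitivity (fsint p (fun=> q x * 1)); last by rewrite fsintZ fsint1 mulr1.
  apply: eq_fsint => y _; rewrite fsint_push mulr1 -[RHS]fsint_delta.
  exact: eq_fsint.
Qed.

Let cost_has_inf p q : has_inf (transport_cost @` coupling p q).
Proof.
split; last by exists 0; exact: cost_ge0.
by have [c pqc] := coupling_neq0 p q; exists (transport_cost c), c.
Qed.

Let wasserstein_ge0 p q : 0 <= wasserstein p q.
Proof. by apply: lb_le_inf; [case: (cost_has_inf p q)|exact: cost_ge0]. Qed.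

Let wasserstein_le p q c : coupling p q c -> wasserstein p q <= transport_cost c.
Proof.
by move=> pqc; apply: ge_inf; [case: (cost_has_inf p q)|exists c].
Qed.

Let wassersteinxx p : wasserstein p p = 0.
Proof.
apply/eqP; rewrite eq_le wasserstein_ge0 andbT.
have pp : coupling p p (push (fun x => (x, x)) p).
  split; first by apply: push_ge0 => x; exact: weight_ge0.
  - by rewrite push_comp push_id.
  - by rewrite push_comp push_id.
apply: le_trans (wasserstein_le pp) _.
rewrite costE fsint_push /fsint big1// => x _.
by rewrite /= mdistxx mulr0.
Qed.

Let wasserstein_sym_le p q : wasserstein p q <= wasserstein q p.
Proof.
apply: lb_le_inf; first by case: (cost_has_inf q p).
move=> _ [c [c0 cq cp] <-].
pose c' := push (fun z : Y * Y => (z.2, z.1)) c.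
have pqc : coupling p q c'.
  by split; [exact: push_ge0|rewrite push_comp|rewrite push_comp].
apply: le_trans (wasserstein_le pqc) _.
rewrite !costE fsint_push.
by rewrite le_eqVlt; apply/orP; left; apply/eqP/eq_fsint => z _ /=; rewrite metric_sym.
Qed.

Let wasserstein_sym p q : wasserstein p q = wasserstein q p.
Proof. by apply/eqP; rewrite eq_le !wasserstein_sym_le. Qed.

Let coupling_glue p q s c d : coupling p q c -> coupling q s d ->
  exists2 b, coupling p s b &
    transport_cost b <= transport_cost c + transport_cost d.
Proof.
move=> [c0 cp cq] [d0 dq ds].
pose w (x : Y * Y) (y : Y * Y) : R := (y.1 == x.2)%:R / q x.2.
have w0 x y : 0 <= w x y by rewrite divr_ge0// weight_ge0.
pose g := fsbind c (fun x => push (pair x) (reweight (w x) d)).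
have g0 z : 0 <= g z.
  rewrite fsbindE fsint_ge0// => x; apply: push_ge0 => y.
  by rewrite reweightE mulr_ge0.
have gE h : fsint g h = fsint c (fun x => fsint d (fun y => w x y * h (x, y))).
  rewrite fsint_bind; apply: eq_fsint => x _.
  by rewrite fsint_push fsint_reweight.
have qc x : x \in finsupp c -> q x.2 != 0.
  move=> xc; rewrite -mem_finsupp -cq finsupp_push//.
  by apply/imfsetP; exists x.
have qd y : y \in finsupp d -> q y.1 != 0.
  move=> yd; rewrite -mem_finsupp -dq finsupp_push//.
  by apply/imfsetP; exists y.
have g1 h : fsint g (h \o fst) = fsint c h.
  rewrite gE; apply: eq_fsint => x /qc qx /=.
  transitivity (h x / q x.2 * fsint d (fun y => (y.1 == x.2)%:R)).
    by rewrite -fsintZ; apply: eq_fsint => y _; rewrite /w mulrC mulrCA mulrC.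
  by rewrite -pushE dq divfK.
have g2 h : fsint g (h \o snd) = fsint d h.
  rewrite gE exchange_fsint; apply: eq_fsint => y /qd qy /=.
  transitivity (h y / q y.1 * fsint c (fun x => (x.2 == y.1)%:R)).
    rewrite -fsintZ; apply: eq_fsint => x _; rewrite /w eq_sym.
    by case: eqP => [->|_]; rewrite ?mul1r ?mul0r ?mulr1 ?mulr0 // mulrC.
  by rewrite -pushE cq divfK.
exists (push (fun z : (Y * Y) * (Y * Y) => (z.1.1, z.2.2)) g).
  split; first exact: push_ge0.
  - rewrite push_comp -cp; apply/fsfunP => x; rewrite !pushE -g1.
    exact: eq_fsint.
  - rewrite push_comp -ds; apply/fsfunP => x; rewrite !pushE -g2.
    exact: eq_fsint.
rewrite !costE fsint_push.
rewrite -g1 -g2 -fsintD !gE; apply: ler_fsint => // x _; apply: ler_fsint => // y _.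
rewrite /= /w; case: eqP => [->|_]; last by rewrite !mul0r.
by rewrite ler_wpM2l ?mul1r ?invr_ge0 ?weight_ge0// metric_triangle.
Qed.

Let wasserstein_triangle q p s :
  wasserstein p s <= wasserstein p q + wasserstein q s.
Proof.
apply/ler_addgt0Pl => e e0; have e20 : 0 < e / 2 by rewrite divr_gt0.
have [_ [c pqc <-] cl] := inf_adherent e20 (cost_has_inf p q).
have [_ [d qsd <-] dl] := inf_adherent e20 (cost_has_inf q s).
have [b psb bl] := coupling_glue pqc qsd.
apply: le_trans (wasserstein_le psb) _; apply: le_trans bl _.
apply: le_trans (lerD (ltW cl) (ltW dl)) _.
by rewrite addrACA -splitr addrC.
Qed.

Let wasserstein_weight p q x : wasserstein p q = 0 -> p x <= q x.
Proof.
move=> pq0.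
have [e e0 eA] := mdist_separated x (finsupp p `|` finsupp q)%fset.
suff : e * (p x - q x) <= wasserstein p q.
  by rewrite pq0 pmulr_rle0// subr_le0.
apply: lb_le_inf; first by case: (cost_has_inf p q).
move=> _ [c [c0 cp cq] <-].
rewrite -cp -cq !pushE mulrBr -mulrN -mulN1r -!fsintZ -fsintD.
rewrite costE.
apply: ler_fsint => // -[y z] yzc /=.
have yA : y \in (finsupp p `|` finsupp q)%fset.
  rewrite inE -{1}cp finsupp_push//; apply/orP; left.
  by apply/imfsetP; exists (y, z).
have zA : z \in (finsupp p `|` finsupp q)%fset.
  rewrite inE -{1}cq finsupp_push//; apply/orP; right.
  by apply/imfsetP; exists (y, z).
have [->|yx] := eqVneq y x; have [->|zx] := eqVneq z x.
- by rewrite mulN1r mulr1 mulrN mulr1 subrr mdist_ge0.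
- by rewrite mulr0 mulr0 mulr1 addr0 eA.
- rewrite mulr0 add0r mulr1 mulrN1 (le_trans _ (mdist_ge0 _ _))//.
  by rewrite oppr_le0 ltW.
- by rewrite !mulr0 addr0 mdist_ge0.
Qed.

Let wasserstein_positivity p q : wasserstein p q = 0 -> p = q.
Proof.
move=> pq0; apply/val_inj/fsfunP => x; apply/eqP; rewrite eq_le.
by rewrite !wasserstein_weight// wasserstein_sym.
Qed.

HB.instance Definition _ := isMetric.Build R thickening
  wassersteinxx wasserstein_positivity wasserstein_sym wasserstein_triangle.

Lemma mdist_thickening p q : mdist p q = wasserstein p q.
Proof. by []. Qed.

End Thickening.

Record group_action (G : groupType) (T : Type) := GroupAction {
  act :> G -> T -> T;
  act1 : forall x, act 1%g x = x;
  actM : forall g h x, act (g * h)%g x = act g (act h x) }.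

Section OrbitSpace.
Variables (G : groupType) (T : choiceType) (a : group_action G T).

Lemma actK g : cancel (a g) (a g^-1%g).
Proof. by move=> x; rewrite -actM mulVg act1. Qed.

Lemma actVK g : cancel (a g^-1%g) (a g).
Proof. by move=> x; rewrite -actM mulgV act1. Qed.

Definition orbit_rel : rel T := fun x y => `[< exists g, y = a g x >].

Lemma orbit_relP x y : reflect (exists g, y = a g x) (orbit_rel x y).
Proof. exact: asboolP. Qed.

Fact orbit_rel_refl : reflexive orbit_rel.
Proof. by move=> x; apply/orbit_relP; exists 1%g; rewrite act1. Qed.

Fact orbit_rel_sym : symmetric orbit_rel.
Proof.
move=> x y; apply/orbit_relP/orbit_relP => -[g ->]; exists g^-1%g;
  by rewrite actK.
Qed.

Fact orbit_rel_trans : transitive orbit_rel.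
Proof.
move=> y x z /orbit_relP[g ->] /orbit_relP[h ->].
by apply/orbit_relP; exists (h * g)%g; rewrite actM.
Qed.

Canonical orbit_equiv :=
  EquivRel orbit_rel orbit_rel_refl orbit_rel_sym orbit_rel_trans.

Definition orbit_set := {eq_quot orbit_equiv}%qT.

HB.instance Definition _ := EqQuotient.on orbit_set.
HB.instance Definition _ := Choice.on orbit_set.

Lemma orbit_eqP x y :
  (\pi_orbit_set x = \pi_orbit_set y)%qT <-> exists g, y = a g x.
Proof. by split=> [/eqmodP/orbit_relP|xy]; last exact/eqmodP/orbit_relP. Qed.

End OrbitSpace.

Definition orbit_space (G : groupType) (T : topologicalType)
  (a : group_action G T) := quotient_topology (orbit_set a).

Section MetricActions.
Variables (R : realType) (G : groupType) (X : metricType R).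
Variable a : group_action G X.

Definition isometric_action := forall g x y, mdist (a g x) (a g y) = mdist x y.

Definition proper_action := forall x, exists2 rho : R, 0 < rho &
  finite_set [set g | (a g @` ball x rho) `&` ball x rho !=set0].

End MetricActions.

(* The set X / G with the quotient metric; the two proofs make it a metric. *)
Definition metric_orbit_space (R : realType) (G : groupType) (X : metricType R)
  (a : group_action G X) (isom : isometric_action a) (prop : proper_action a) :
  Type := orbit_set a.

Section QuotientMetric.
Variables (R : realType) (G : groupType) (X : metricType R).
Variable a : group_action G X.
Hypotheses (isom : isometric_action a) (prop : proper_action a).

Local Notation XG := (metric_orbit_space isom prop).

HB.instance Definition _ := Choice.copy XG (orbit_set a).
HB.instance Definition _ := Quotient.copy XG (orbit_set a).

Definition orbit_class (x : X) : XG := (\pi_XG x)%qT.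

Let orbit_classP x y : orbit_class x = orbit_class y <-> exists g, y = a g x.
Proof. exact: (@orbit_eqP _ _ a). Qed.

Let orbit_classJ g x : orbit_class (a g x) = orbit_class x.
Proof. by apply/esym/orbit_classP; exists g. Qed.

Let orbit_class_repr (u : XG) : orbit_class (repr u) = u.
Proof. exact: reprK. Qed.

Definition orbit_dist (u v : XG) : R :=
  inf (range (fun g => mdist (repr u) (a g (repr v)))).

Let dists x y := range (fun g => mdist x (a g y)).

Let dists_has_inf x y : has_inf (dists x y).
Proof.
split; first by exists (mdist x (a 1%g y)), 1%g.
by exists 0 => _ [g _ <-]; exact: mdist_ge0.
Qed.

Let distsJ g h x y : dists (a g x) (a h y) = dists x y.
Proof.
apply/seteqP; split => _ [k _ <-].
  by exists (g^-1 * k * h)%g => //; rewrite -(isom g) !actM actVK.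
by exists (g * k * h^-1)%g => //; rewrite !actM actK isom.
Qed.

Lemma orbit_distE x y :
  orbit_dist (orbit_class x) (orbit_class y) =
  inf (range (fun g => mdist x (a g y))).
Proof.
rewrite /orbit_dist.
have /orbit_classP[g gx] := esym (orbit_class_repr (orbit_class x)).
have /orbit_classP[h hy] := esym (orbit_class_repr (orbit_class y)).
by rewrite {}gx {}hy -/(dists _ _) distsJ.
Qed.

Let orbit_dist_le x y g :
  orbit_dist (orbit_class x) (orbit_class y) <= mdist x (a g y).
Proof.
rewrite orbit_distE; apply: ge_inf; last by exists g.
by case: (dists_has_inf x y).
Qed.

Let orbit_dist_lt x y e : 0 < e ->
  exists g, mdist x (a g y) < orbit_dist (orbit_class x) (orbit_class y) + e.
Proof.
move=> e0; rewrite orbit_distE.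
by have [_ [g _ <-]] := inf_adherent e0 (dists_has_inf x y); exists g.
Qed.

Let orbit_dist_ge0 u v : 0 <= orbit_dist u v.
Proof.
apply: lb_le_inf; first by case: (dists_has_inf (repr u) (repr v)).
by move=> _ [g _ <-]; exact: mdist_ge0.
Qed.

Let orbit_distxx u : orbit_dist u u = 0.
Proof.
apply/eqP; rewrite eq_le orbit_dist_ge0 andbT -{1 2}(orbit_class_repr u).
by apply: le_trans (orbit_dist_le _ _ 1%g) _; rewrite act1 mdistxx.
Qed.

Let orbit_dist_sym_le u v : orbit_dist u v <= orbit_dist v u.
Proof.
rewrite -(orbit_class_repr u) -(orbit_class_repr v).
apply/ler_addgt0Pr => e e0; have [g gl] := orbit_dist_lt (repr v) (repr u) e0.
apply: le_trans (ltW gl); apply: le_trans (orbit_dist_le _ _ g^-1%g) _.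
by rewrite -(isom g) actVK metric_sym.
Qed.

Let orbit_dist_sym u v : orbit_dist u v = orbit_dist v u.
Proof. by apply/eqP; rewrite eq_le !orbit_dist_sym_le. Qed.

Let orbit_dist_triangle v u w :
  orbit_dist u w <= orbit_dist u v + orbit_dist v w.
Proof.
rewrite -(orbit_class_repr u) -(orbit_class_repr v) -(orbit_class_repr w).
apply/ler_addgt0Pr => e e0; have e20 : 0 < e / 2 by rewrite divr_gt0.
have [g gl] := orbit_dist_lt (repr u) (repr v) e20.
have [h hl] := orbit_dist_lt (repr v) (repr w) e20.
apply: le_trans (orbit_dist_le _ _ (g * h)%g) _.
rewrite actM; apply: le_trans (metric_triangle _ (a g (repr v)) _) _.
by rewrite isom [e]splitr addrACA lerD// ltW.
Qed.

Let orbit_dist_positivity u v : orbit_dist u v = 0 -> u = v.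
Proof.
rewrite -(orbit_class_repr u) -(orbit_class_repr v).
set x := repr u; set y := repr v => d0.
have [rho rho0 fin] := prop x.
have near e : 0 < e -> exists g, mdist x (a g y) < e.
  by move=> e0; have [g] := orbit_dist_lt x y e0; rewrite d0 add0r; exists g.
have [h hrho] := near rho rho0; have /finite_seqP[s sE] := fin.
have [e e0 eA] := mdist_separated x [seq a k (a h y) | k <- s].
have [g] := near (Num.min e rho) ltac:(by rewrite lt_min e0 rho0).
rewrite lt_min => /andP[ge grho].
suff gy : a g y = x by rewrite -gy orbit_classJ.
apply/eqP/negP => /negP gyx; move: ge; rewrite ltNge => /negP; apply; apply: eA => //.
apply/mapP; exists (g * h^-1)%g; last by rewrite actM actK.
have : [set` s] (g * h^-1)%g; last by [].
rewrite -sE /=; exists (a g y); rewrite ballEmdist/=; split=> //.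
by exists (a h y); rewrite ?ballEmdist//= actM actK.
Qed.

HB.instance Definition _ := isMetric.Build R XG
  orbit_distxx orbit_dist_positivity orbit_dist_sym orbit_dist_triangle.

End QuotientMetric.

Definition nerve_action (R : realType) (G : groupType) (X : metricType R)
  (a : group_action G X) (isom : isometric_action a) (prop : proper_action a)
  (t : R) :=
  forall (k : nat) (x : 'I_k.+1 -> X),
    \bigcap_i ball (orbit_class isom prop (x i)) t !=set0 ->
    exists! g : {ffun 'I_k.+1 -> G},
      g ord0 = 1%g /\ \bigcap_i ball (a (g i) (x i)) t !=set0.

Section Cech.
Variables (R : realType) (Y : metricType R).

(* The library's closed_ball is the closure of the open ball, which may be
   smaller. *)
Definition mdist_cball (y : Y) (r : R) : set Y := [set z | mdist y z <= r].

Section Nerve.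
Variable B : Y -> set Y.

Definition nerve_simplex (S : {fset Y}) :=
  S != fset0 /\ \bigcap_(y in [set` S]) B y !=set0.

Fact nerve_simplex_neq0 S : nerve_simplex S -> S != fset0.
Proof. by case. Qed.

Fact nerve_simplex_sub S T : (S `<=` T)%fset -> S != fset0 ->
  nerve_simplex T -> nerve_simplex S.
Proof.
move=> /fsubsetP ST S0 [_ [z Tz]]; split=> //.
by exists z => y /= /ST; exact: Tz.
Qed.

Definition ball_nerve := SimplicialComplex nerve_simplex_neq0 nerve_simplex_sub.

End Nerve.

Definition cech_lt r := ball_nerve (fun y => ball y r).

Definition cech_le r := ball_nerve (fun y => mdist_cball y r).

End Cech.
Arguments cech_lt {R} Y r.
Arguments cech_le {R} Y r.

Definition invariant_complex (G : groupType) (V : choiceType)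
    (a : group_action G V) (K : simplicial_complex V) :=
  forall g S, K S -> K (a g @` S)%fset.

Section InducedAction.
Variables (R : realType) (G : groupType) (V : choiceType).
Variables (a : group_action G V) (K : simplicial_complex V).
Hypothesis aK : invariant_complex a K.

Let act g := @induced_map R V V K K (a g) (aK g).

Fact induced_act1 p : act 1%g p = p.
Proof. by apply/val_inj/push_id => x; exact: act1. Qed.

Fact induced_actM g h p : act (g * h)%g p = act g (act h p).
Proof.
apply/val_inj; rewrite /= push_comp; congr (push _ _).
by apply/funext => x; exact: actM.
Qed.

Definition induced_action : group_action G (realization R K) :=
  GroupAction induced_act1 induced_actM.

End InducedAction.
Arguments induced_action R {G V a K} aK.

Section CechAction.
Variables (R : realType) (G : groupType) (X : metricType R).
Variable a : group_action G X.
Hypothesis isom : isometric_action a.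

Let ball_nerve_invariant (B : X -> set X) :
  (forall g x y, B x y -> B (a g x) (a g y)) ->
  invariant_complex a (ball_nerve B).
Proof.
move=> BJ g S [/fset0Pn[x xS] [z Sz]]; split.
  by apply/fset0Pn; exists (a g x); apply/imfsetP; exists x.
by exists (a g z) => _ /imfsetP[y /= yS ->]; apply: BJ; exact: Sz.
Qed.

Fact cech_lt_invariant r : invariant_complex a (cech_lt X r).
Proof.
by apply: ball_nerve_invariant => g x y; rewrite !ballEmdist/= isom.
Qed.

Fact cech_le_invariant r : invariant_complex a (cech_le X r).
Proof.
by apply: ball_nerve_invariant => g x y; rewrite /mdist_cball/= isom.
Qed.

Definition cech_lt_action r := induced_action R (@cech_lt_invariant r).

Definition cech_le_action r := induced_action R (@cech_le_invariant r).

Definition cech_lt_thickening_action r :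
  group_action G (thickening (cech_lt X r)) := cech_lt_action r.

Definition cech_le_thickening_action r :
  group_action G (thickening (cech_le X r)) := cech_le_action r.

End CechAction.

Definition homeomorphism (S T : topologicalType) (f : S -> T) :=
  continuous f /\ exists g, [/\ cancel f g, cancel g f & continuous g].

Definition homeomorphic (S T : topologicalType) :=
  exists f : S -> T, homeomorphism f.

Section SimplicialStructure.
Variable R : realType.

Fact full_simplex_sub n (S T : {fset 'I_n.+1}) : (S `<=` T)%fset ->
  S != fset0 -> T != fset0 -> S != fset0.
Proof. by []. Qed.

Definition full_simplex n : simplicial_complex 'I_n.+1 :=
  SimplicialComplex (fun S => id) (@full_simplex_sub n).

Definition std_simplex n := realization R (full_simplex n).

(* A simplicial structure on a space is given by the characteristic maps of its
   n-simplices, one for each ordering of the n + 1 vertices. *)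
Definition simplicial_structure (Z : Type) :=
  forall n, set (std_simplex n -> Z).

(* c sends \sum_i p_i * i to \sum_i p_i * s_i, for distinct vertices s_i; that
   these span a simplex of K follows from the type of c. *)
Definition realization_structure (V : choiceType) (K : simplicial_complex V) :
    simplicial_structure (realization R K) :=
  fun n => [set c | exists2 s : 'I_n.+1 -> V, injective s &
                      forall p, weight (c p) = push s (weight p)].

(* the images of the simplices of K *)
Definition orbit_structure (G : groupType) (V : choiceType)
    (K : simplicial_complex V) (b : group_action G (realization R K)) :
    simplicial_structure (orbit_space b) :=
  fun n => [set \pi_(orbit_space b)%qT \o c | c in @realization_structure V K n].

Definition simplicial_isomorphic (Z Z' : topologicalType)
    (D : simplicial_structure Z) (D' : simplicial_structure Z') :=
  exists2 f : Z -> Z', homeomorphism f &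
    forall n (c : std_simplex n -> Z), D n c <-> D' n (f \o c).

End SimplicialStructure.
Arguments realization_structure R {V} K.
Arguments orbit_structure {R G V K} b.

(* Main.v *)
(* All four maps are induced by p |-> push orbit_class p, which is
   surjective with the G-orbits as its fibres. The nerve condition enters only
   through the uniqueness of lifts of pairs: if the t-balls around x and y meet,
   and those around x and h y meet, then h = 1. Hence a simplex of the quotient
   lifts, uniquely up to translation, to a simplex upstairs that it matches
   vertex by vertex, and distances < t are attained. For the weak topology the
   map is a bijection of barycentric coordinates on each lifted simplex, so it
   carries invariant open sets to open sets. For the thickenings it is
   1-Lipschitz, and it is open because a cheap coupling of (the image of p) with
   q lifts to a coupling of p with a lift of q, at a cost larger by a factor
   depending only on p. *)
Require Import Defs.
From mathcomp Require Import all_boot all_order all_algebra finmap generic_quotient.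
From mathcomp Require Import all_classical all_reals all_analysis lra.

Set Implicit Arguments.
Unset Strict Implicit.
Unset Printing Implicit Defensive.

Import Order.TTheory GRing.Theory Num.Theory.

Local Open Scope classical_set_scope.
Local Open Scope ring_scope.

(** The fibre condition makes [P] descend to a bijection from the orbit space, inverted by taking
    classes of preimages. Openness is asked only of invariant sets, because preimages under the
    quotient map are invariant. *)
Lemma orbit_homeomorphism (G : groupType) (T Z : topologicalType)
    (b : group_action G T) (P : T -> Z) :
  continuous P ->
  (forall p q, P p = P q <-> exists g, q = b g p) ->
  (forall z, exists p, P p = z) ->
  (forall U, open U -> (forall g p, U p -> U (b g p)) -> open (P @` U)) ->
  exists2 f : Z -> orbit_space b, homeomorphism f &
    forall p, f (P p) = (\pi_(orbit_space b) p)%qT.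
Proof.
move=> Pcont Pfib Psurj Popen.
have [s sK] := choice Psurj.
pose pr p : orbit_space b := (\pi_(orbit_space b) p)%qT.
have prP p q : pr p = pr q <-> exists g, q = b g p by exact: (@orbit_eqP _ _ b).
have fP p : pr (s (P p)) = pr p by apply/prP/Pfib; rewrite sK.
have prK u : pr (repr u) = u by exact: reprK.
have gpr p : P (repr (pr p)) = P p by apply/Pfib/prP; rewrite prK.
exists (pr \o s) => //; split; last first.
  exists (P \o repr); split.
  - by move=> z /=; rewrite gpr sK.
  - by move=> u /=; rewrite fP prK.
  - apply/continuousP => A oA.
    have : open (P @^-1` A) by move/continuousP : Pcont; apply.
    congr open; apply/seteqP; split => p /=; by rewrite gpr.
apply/continuousP => A oA.
suff -> : (pr \o s) @^-1` A = P @` (pr @^-1` A).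
  apply: Popen => // g p /=; congr A; apply/prP.
  by exists g.
apply/seteqP; split => [z /= Az|_ [p /= Ap <-] /=]; last by rewrite fP.
by exists (s z) => //; rewrite sK.
Qed.

(** * Pushforwards along maps injective on a support *)

Section FiniteSums.
Variable R : realType.

Local Notation fsf T := {fsfun T -> R with 0}.

Lemma push_inj_in (T U : choiceType) (g : T -> U) (A : {fset T}) (f : fsf T) x :
  {in A &, injective g} -> {subset finsupp f <= A} -> x \in A ->
  push g f (g x) = f x.
Proof.
move=> ginj fA xA; rewrite pushE -[RHS]fsint_delta; apply: eq_fsint => y /fA yA.
by rewrite (inj_in_eq ginj).
Qed.

Lemma eq_push (T U : choiceType) (g h : T -> U) (f : fsf T) :
  {in finsupp f, g =1 h} -> push g f = push h f.
Proof.
move=> gh; apply/fsfunP => u; rewrite !pushE; apply: eq_fsint => x xf.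
by rewrite gh.
Qed.

Lemma push_id_in (T : choiceType) (g : T -> T) (f : fsf T) :
  {in finsupp f, g =1 id} -> push g f = f.
Proof. by move=> gid; rewrite (@eq_push _ _ _ id)// push_id. Qed.

End FiniteSums.

(** * Quotient distances and uniqueness of lifts *)

Section QuotientGeometry.
Variables (R : realType) (G : groupType) (X : metricType R).
Variables (a : group_action G X).
Variables (isom : isometric_action a) (prop : proper_action a).
Local Notation XG := (metric_orbit_space isom prop).
Local Notation cl := (orbit_class isom prop).

Lemma orbit_classP x y : cl x = cl y <-> exists g, y = a g x.
Proof. exact: (@orbit_eqP _ _ a). Qed.

Lemma orbit_classJ g x : cl (a g x) = cl x.
Proof. by apply/esym/orbit_classP; exists g. Qed.

Lemma orbit_class_repr (u : XG) : cl (repr u) = u.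
Proof. exact: reprK. Qed.

Lemma mdist_orbit_classE x y :
  mdist (cl x) (cl y) = inf (range (fun g => mdist x (a g y))).
Proof. exact: orbit_distE. Qed.

Lemma orbit_dists_has_inf x y : has_inf (range (fun g => mdist x (a g y))).
Proof.
split; first by exists (mdist x (a 1%g y)), 1%g.
by exists 0 => _ [g _ <-]; exact: mdist_ge0.
Qed.

Lemma mdist_orbit_class_le x y : mdist (cl x) (cl y) <= mdist x y.
Proof.
rewrite mdist_orbit_classE; apply: ge_inf; last by exists 1%g; rewrite ?act1.
by case: (orbit_dists_has_inf x y).
Qed.

Lemma mdist_orbit_class_lt x y s : mdist (cl x) (cl y) < s ->
  exists g, mdist x (a g y) < s.
Proof.
rewrite mdist_orbit_classE -subr_gt0 => /inf_adherent.
move=> /(_ _ (orbit_dists_has_inf x y))[_ [g _ <-]].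
by rewrite addrC subrK; exists g.
Qed.

Variable t : R.
Hypothesis nerve : nerve_action isom prop t.

(* Uniqueness in the nerve condition for the two points x and y, which both
   (1, 1) and (1, h) solve. *)
Lemma nerve_pair x y z w h : mdist x z < t -> mdist y z < t ->
  mdist x w < t -> mdist (a h y) w < t -> h = 1%g.
Proof.
move=> xz yz xw yw.
pose s (i : 'I_2) := if i == ord0 then x else y.
have [|g [_ gU]] := @nerve 1%N s.
  exists (cl z) => i _; rewrite ballEmdist /s /=.
  by case: ifP => _; apply: le_lt_trans (mdist_orbit_class_le _ _) _.
pose k (i : 'I_2) := if i == ord0 then 1%g else h.
have : g = [ffun=> 1%g].
  apply: gU; split; first by rewrite ffunE.
  exists z => i _; rewrite ballEmdist /s /= ffunE act1; by case: ifP.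
have : g = [ffun i => k i].
  apply: gU; split; first by rewrite ffunE.
  exists w => i _; rewrite ballEmdist /s /k /= ffunE.
  by case: ifP; rewrite ?act1.
by move=> -> /ffunP/(_ ord_max); rewrite !ffunE /k.
Qed.

(** By [nerve_pair], only one translate of [y] lies within [t] of [x]. So the translates nearly
    realizing the infimum are all equal to this one. *)
Lemma mdist_orbit_class_attained x y : mdist (cl x) (cl y) < t ->
  exists g, mdist x (a g y) = mdist (cl x) (cl y).
Proof.
move=> xyt; have [g gt] := mdist_orbit_class_lt xyt; exists g.
apply/eqP; rewrite eq_le -{2}(orbit_classJ g y) mdist_orbit_class_le andbT.
apply/ler_addgt0Pr => e e0.
have : mdist (cl x) (cl y) < Num.min (mdist (cl x) (cl y) + e) t.
  by rewrite lt_min xyt ltrDl e0.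
move=> /mdist_orbit_class_lt[h]; rewrite lt_min => /andP[he ht].
suff /divg1_eq <- : (h / g)%g = 1%g by exact: ltW.
by apply: (@nerve_pair (a g y) (a g y) x x); rewrite -?actM ?mulgVK metric_sym.
Qed.

End QuotientGeometry.

(** * Points and vertices of realizations *)

Section Realizations.
Variables (R : realType).

Lemma realization_push (V W : choiceType) (K : simplicial_complex V)
    (L : simplicial_complex W) (f : V -> W) (p : realization R K) :
  L (f @` finsupp p)%fset ->
  exists q : realization R L, weight q = push f p.
Proof.
move=> Lf; have p0 := weight_ge0 p.
have qP : `[< [/\ forall w, 0 <= push f p w,
    \sum_(w <- finsupp (push f p)) push f p w = 1
  & L (finsupp (push f p))] >].
  apply/asboolP; split; first exact: push_ge0.
    by rewrite sum_push weight_sum1.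
  by rewrite finsupp_push.
by exists (Realization qP).
Qed.

Lemma open_weakE (V : choiceType) (K : simplicial_complex V)
  (U : set (realization R K)) : open U = weak_open U.
Proof. by []. Qed.

Lemma finsupp_neq0 (V : choiceType) (K : simplicial_complex V)
  (p : realization R K) : exists x, x \in finsupp p.
Proof. exact/fset0Pn/(simplex_neq0 (weight_simplex p)). Qed.

(** The barycentre; its image under a characteristic map has all the vertices in its support, so
    they span a simplex. *)
Lemma std_simplex_full n : exists p : std_simplex R n, forall i, i \in finsupp p.
Proof.
pose A : {fset 'I_n.+1} := [fset i in enum 'I_n.+1]%fset.
have AT i : i \in A by rewrite !inE mem_enum.
pose w : {fsfun 'I_n.+1 -> R with 0} := [fsfun i in A => n.+1%:R^-1].
have wE i : w i = n.+1%:R^-1 by rewrite fsfunE AT.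
have wS i : i \in finsupp w by rewrite mem_finsupp wE invr_eq0 pnatr_eq0.
have wP : `[< [/\ forall v, 0 <= w v, \sum_(v <- finsupp w) w v = 1
              & full_simplex n (finsupp w)] >].
  apply/asboolP; split; last by apply/fset0Pn; exists ord0.
    by move=> i; rewrite wE invr_ge0.
  under eq_bigr do rewrite wE.
  rewrite (perm_big (enum 'I_n.+1)) /=.
    by rewrite big_enum /= sumr_const card_ord -[X in X *+ _]mulr1 -mulrnAr mulVf ?pnatr_eq0.
  apply: uniq_perm; rewrite ?enum_uniq ?fset_uniq// => i.
  by rewrite mem_enum wS.
by exists (Realization wP).
Qed.

Lemma simplicial_structure_vertices (V : choiceType) (K : simplicial_complex V)
    n (c : std_simplex R n -> realization R K) (s : 'I_n.+1 -> V) :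
  (forall p, weight (c p) = push s (weight p)) ->
  exists2 S, K S & forall i, s i \in S.
Proof.
move=> cs; have [p pT] := std_simplex_full n.
exists (finsupp (c p)); first exact: weight_simplex.
move=> i; rewrite cs finsupp_push; last exact: weight_ge0.
by apply/imfsetP; exists i => //; exact: pT.
Qed.

End Realizations.

(** * Couplings and the Wasserstein distance *)

Section Wasserstein.
Variables (R : realType) (Y : metricType R) (K : simplicial_complex Y).
Implicit Types p q : thickening K.

Lemma transport_costE (c : {fsfun Y * Y -> R with 0}) :
  transport_cost c = fsint c (fun z => mdist z.1 z.2).
Proof. by []. Qed.

Lemma mdist_le_cost p q c : coupling p q c -> mdist p q <= transport_cost c.
Proof.
move=> pqc; rewrite mdist_thickening; apply: ge_inf; last by exists c.
exists 0 => _ [d [d0 _ _] <-]; apply: sumr_ge0 => z _.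
by rewrite mulr_ge0// mdist_ge0.
Qed.

Lemma coupling_diag p : exists2 c, coupling p p c & transport_cost c = 0.
Proof.
exists (push (fun x => (x, x)) p).
  split; first by apply: push_ge0 => x; exact: weight_ge0.
  - by rewrite push_comp push_id.
  - by rewrite push_comp push_id.
rewrite transport_costE fsint_push /fsint big1// => x _.
by rewrite /= mdistxx mulr0.
Qed.

(* If there were no coupling, the infimum would be the junk value 0, whence
   p = q, but the diagonal couples p with itself. *)
Lemma mdist_lt_cost p q s : mdist p q < s ->
  exists2 c, coupling p q c & transport_cost c < s.
Proof.
move=> pqs.
have [E|/set0P[c0 pqc0]] := eqVneq (@transport_cost R Y @` coupling p q) set0.
  have pq0 : mdist p q = 0 by rewrite mdist_thickening /wasserstein E inf0.
  have [c] := coupling_diag p; rewrite {2}(mdist_positivity _ _ pq0) => pqc c0.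
  by exists c; rewrite // c0 -pq0.
have hinf : has_inf (@transport_cost R Y @` coupling p q).
  split; first by exists c0.
  exists 0 => _ [d [d0 _ _] <-]; apply: sumr_ge0 => z _.
  by rewrite mulr_ge0// mdist_ge0.
move: pqs; rewrite -subr_gt0 => /inf_adherent /(_ hinf)[_ [c pqc <-]].
by rewrite -/(wasserstein p q) -mdist_thickening addrC subrK; exists c.
Qed.

End Wasserstein.

(** Gives the margin by which all vertices of a simplex stay within [t] of a centre. *)
Lemma finite_gap (R : realType) (T : choiceType) (A : seq T) (f : T -> R) t :
  (forall x, x \in A -> f x < t) ->
  exists2 e, 0 < e & forall x, x \in A -> f x + e <= t.
Proof.
elim: A => [|x A IH] fA; first by exists 1.
have [|e e0 eA] := IH; first by move=> y yA; apply: fA; rewrite inE yA orbT.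
have fx : f x < t by apply: fA; rewrite inE eqxx.
exists (Num.min e (t - f x)); first by rewrite lt_min e0 subr_gt0.
move=> y; rewrite inE => /predU1P[->|/eA]; rewrite -!lerBrDl ge_min.
  by rewrite lexx orbT.
by move=> ->.
Qed.

(** * Simplices of the quotient and their lifts *)

Section OrbitNerve.
Variables (R : realType) (G : groupType) (X : metricType R).
Variables (a : group_action G X).
Variables (isom : isometric_action a) (prop : proper_action a).
Local Notation XG := (metric_orbit_space isom prop).
Local Notation cl := (orbit_class isom prop).
Variable t : R.
Hypotheses (t0 : 0 < t) (nerve : nerve_action isom prop t).

(* close d stands for d < r or d <= r. *)
Variable close : R -> Prop.
Hypothesis close_lt : forall d, close d -> d < t.
Hypothesis close_le : forall d e, d <= e -> close e -> close d.

Variables (K : simplicial_complex X) (L : simplicial_complex XG).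
Hypothesis KE : forall S, K S <->
  S != fset0 /\ exists z, forall x, x \in S -> close (mdist x z).
Hypothesis LE : forall T, L T <->
  T != fset0 /\ exists z, forall x, x \in T -> close (mdist x z).
Hypothesis aK : invariant_complex a K.

Lemma simplex_center S : K S ->
  exists z, forall x, x \in S -> mdist x z < t.
Proof. by move=> /KE[_ [z zS]]; exists z => x /zS/close_lt. Qed.

Lemma simplex_orbit_class S : K S -> L (cl @` S)%fset.
Proof.
move=> /KE[/fset0Pn[x xS] [z zS]]; apply/LE; split.
  by apply/fset0Pn; exists (cl x); apply/imfsetP; exists x.
exists (cl z) => _ /imfsetP[y /= /zS yz ->].
by apply: close_le yz; exact: mdist_orbit_class_le.
Qed.

(** Fix a representative of a centre [w] of [T]. Distances from it to the vertices are below [t],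
    hence attained, so each vertex has a lift exactly as far from the representative as the vertex
    is from [w]. *)
Lemma simplex_lift T : L T ->
  exists2 s : XG -> X, {in T, cancel s cl} & K (s @` T)%fset.
Proof.
move=> /LE[/fset0Pn[u0 u0T] [w wT]].
have : forall u, exists x, u \in T -> cl x = u /\ close (mdist x (repr w)).
  move=> u; have [uT|] := boolP (u \in T); last by exists (repr u).
  have uw := wT _ uT.
  have : mdist (cl (repr w)) (cl (repr u)) < t.
    by rewrite !orbit_class_repr metric_sym close_lt.
  move=> /(mdist_orbit_class_attained nerve)[g gE].
  exists (a g (repr u)) => _; rewrite orbit_classJ orbit_class_repr; split=> //.
  by rewrite metric_sym gE !orbit_class_repr metric_sym.
move=> /choice[s sT]; exists s => [u uT|]; first by case: (sT u uT).
apply/KE; split; first by apply/fset0Pn; exists (s u0); apply/imfsetP; exists u0.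
by exists (repr w) => _ /imfsetP[u /= uT ->]; case: (sT u uT).
Qed.

(** If [x] and [g x] share a centre, the pair [x], [x] is solved by both [1] and [g]. *)
Lemma orbit_class_inj S : K S -> {in S &, injective cl}.
Proof.
move=> /simplex_center[z zS] x y xS yS /orbit_classP[g yg].
suff g1 : g = 1%g by rewrite yg g1 act1.
by apply: (nerve_pair nerve (x := x) (y := x) (z := z) (w := z));
  rewrite -?yg; apply: zS.
Qed.

Lemma simplex_section (S : {fset X}) : exists s : XG -> X,
  forall u, u \in (cl @` S)%fset -> s u \in S /\ cl (s u) = u.
Proof.
suff /choice[s sP] : forall u, exists x,
    u \in (cl @` S)%fset -> x \in S /\ cl x = u by exists s.
move=> u; have [/imfsetP[x /= xS ->]|] := boolP (u \in (cl @` S)%fset).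
  by exists x.
by exists (repr u).
Qed.

Lemma simplex_section_cancel S : K S ->
  exists s : XG -> X, {in S, cancel cl s}.
Proof.
move=> KS; have [s sP] := simplex_section S.
have sS x : x \in S -> s (cl x) \in S /\ cl (s (cl x)) = cl x.
  by move=> xS; apply: sP; apply/imfsetP; exists x.
exists s => x /[dup] xS /sS[sxS]; exact: (orbit_class_inj KS).
Qed.

(** * The class map on realizations *)

Definition class_map : realization R K -> realization R L :=
  induced_map simplex_orbit_class.

Lemma weight_class_map p : weight (class_map p) = push cl p.
Proof. by []. Qed.

Lemma class_map_surj q : exists p, class_map p = q.
Proof.
have [s scl Ks] := simplex_lift (weight_simplex q).
have [p pE] := @realization_push _ _ _ _ K s q Ks.
exists p; apply: val_inj => /=.
by rewrite pE push_comp push_id_in.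
Qed.

(** The section [s] matches the support of [p] with that of [q] orbit by orbit. The element [g] read
    off at one vertex [x0] must serve every other vertex, by uniqueness of lifts. *)
Lemma class_map_fiber p q :
  class_map p = class_map q <-> exists g, q = induced_action R aK g p.
Proof.
split=> [pq|[g ->]]; last first.
  apply: val_inj; rewrite /= push_comp; apply: eq_push => x _ /=.
  by rewrite orbit_classJ.
have {}pq : push cl p = push cl q by rewrite -!weight_class_map pq.
have supp_pq : (cl @` finsupp p = cl @` finsupp q)%fset.
  by rewrite -!finsupp_push ?pq//; exact: weight_ge0.
have [s sP] := simplex_section (finsupp q).
have sq : {in finsupp q, cancel cl s}.
  move=> x xq; have [//|sS scl] := sP (cl x); first by apply/imfsetP; exists x.
  exact: (orbit_class_inj (weight_simplex q)).
have sp x : x \in finsupp p -> s (cl x) \in finsupp q /\ cl (s (cl x)) = cl x.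
  by move=> xp; apply: sP; rewrite -supp_pq; apply/imfsetP; exists x.
have [x0 x0p] := finsupp_neq0 p.
have [sx0q /esym/orbit_classP[g sx0]] := sp _ x0p.
exists g; apply: val_inj => /=.
have <- : push s (push cl q) = q by rewrite push_comp push_id_in.
rewrite -pq push_comp; apply: eq_push => x xp /=.
have [sxq /esym/orbit_classP[h sx]] := sp _ xp.
have [z zp] := simplex_center (weight_simplex p).
have [z' zq] := simplex_center (weight_simplex q).
(* The pair [g x0], [g x] has centre [g z]; moving its second point by [h / g] gives [g x0], [h x],
   two vertices of [q] with centre [z']. *)
suff /divg1_eq <- : (h / g)%g = 1%g by [].
apply: (nerve_pair nerve (x := a g x0) (y := a g x) (z := a g z) (w := z')).
- by rewrite isom zp.
- by rewrite isom zp.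
- by rewrite -sx0 zq.
- by rewrite -actM mulgVK -sx zq.
Qed.

(** On a simplex [cl] is injective, so barycentric coordinates are unchanged and the same [e]
    works. *)
Lemma class_map_continuous : continuous class_map.
Proof.
apply/continuousP => U; rewrite !open_weakE => oU S KS p Up pS.
have clS x : x \in S -> cl x \in (cl @` S)%fset.
  by move=> xS; apply/imfsetP; exists x.
have suppS (q : realization R K) : (finsupp q `<=` S)%fset ->
    (finsupp (class_map q) `<=` cl @` S)%fset.
  move=> /fsubsetP qS; apply/fsubsetP => u /finsupp_push_sub /imfsetP[x /= xq ->].
  exact/clS/qS.
have [e e0 eU] := oU _ (simplex_orbit_class KS) _ Up (suppS _ pS).
exists e => // q qS pq; apply: eU; first exact: suppS.
move=> _ /imfsetP[x /= xS ->].
by rewrite !(push_inj_in (orbit_class_inj KS))//; [exact: pq|exact/fsubsetP..].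
Qed.

(** All points on [T] lift with the same coordinates to the one simplex that [s] makes of [T], where
    openness of [U] is tested. *)
Lemma class_map_open U : open U ->
  (forall g p, U p -> U (induced_action R aK g p)) -> open (class_map @` U).
Proof.
rewrite !open_weakE => oU UJ T LT _ [p Up <-] pT.
have [s scl Ks] := simplex_lift LT.
have sinj : {in T &, injective s} := can_in_inj scl.
have lift (q : realization R L) : (finsupp q `<=` T)%fset ->
    exists q' : realization R K, [/\ class_map q' = q,
      (finsupp q' `<=` s @` T)%fset & forall v, v \in T -> q' (s v) = q v].
  move=> /fsubsetP qT.
  have sub : (s @` finsupp q `<=` s @` T)%fset.
    by apply/fsubsetP => _ /imfsetP[u /= /qT uT ->]; apply/imfsetP; exists u.
  have [|q' q'E] := @realization_push _ _ _ _ K s q.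
    apply: simplex_sub sub _ Ks; have [x xq] := finsupp_neq0 q.
    by apply/fset0Pn; exists (s x); apply/imfsetP; exists x.
  exists q'; split.
  - apply: val_inj => /=; rewrite q'E push_comp push_id_in// => u /qT; exact: scl.
  - by rewrite q'E finsupp_push//; exact: weight_ge0.
  - by move=> v vT; rewrite q'E (push_inj_in sinj).
have [p' [p'p p'T p's]] := lift _ pT.
have Up' : U p'.
  (* [p'] need not be [p], but it lies in its orbit. *)
  by have /class_map_fiber[g ->] := esym p'p; exact: UJ.
have [e e0 eU] := oU _ Ks _ Up' p'T.
exists e => // q qT pq; have [q' [q'q q'T q's]] := lift _ qT.
exists q' => //; apply: eU => // _ /imfsetP[v /= vT ->].
by rewrite p's// q's//; exact: pq.
Qed.

Lemma orbit_realization_isomorphic :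
  simplicial_isomorphic (realization_structure R L)
    (orbit_structure (induced_action R aK)).
Proof.
have [f fhom fE] := orbit_homeomorphism (b := induced_action R aK)
  class_map_continuous class_map_fiber class_map_surj class_map_open.
exists f => // n c.
have finj : injective f by case: fhom => _ [g [fg _ _]]; exact: can_inj fg.
split=> [[s sinj cs]|[c' [s sinj c's] c'f]].
  have [T LT sT] := simplicial_structure_vertices cs.
  have [l lcl Kl] := simplex_lift LT.
  (* Lift the vertices of [c] through [l] to get a characteristic map upstairs. *)
  have /choice[c' c'E] : forall p : std_simplex R n,
      exists q : realization R K, weight q = push (l \o s) p.
    move=> p; apply: realization_push.
    have sub : ((l \o s) @` finsupp p `<=` l @` T)%fset.
      by apply/fsubsetP => _ /imfsetP[i /= _ ->]; apply/imfsetP; exists (s i).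
    apply: simplex_sub sub _ Kl; have [i ip] := finsupp_neq0 p.
    by apply/fset0Pn; exists (l (s i)); apply/imfsetP; exists i.
  exists c'.
    exists (l \o s) => // i j /= /(congr1 cl).
    by rewrite !lcl// => /sinj.
  apply/funext => p /=; rewrite -fE; congr f.
  apply: val_inj; rewrite /= c'E push_comp cs; apply: eq_push => i _ /=.
  by rewrite lcl.
(* The vertices of [c'] span a simplex, so their classes remain distinct. *)
have [S KS sS] := simplicial_structure_vertices c's.
exists (cl \o s).
  by move=> i j /= /(orbit_class_inj KS) ij; apply/sinj/ij.
move=> p; have -> : c p = class_map (c' p).
  by apply: finj; rewrite fE; move/(congr1 (@^~ p)): c'f.
by rewrite weight_class_map c's push_comp.
Qed.

(** * The class map on metric thickenings *)

Definition thick_class_map : thickening K -> thickening L := class_map.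

(** Pushing a coupling forward along [cl] in both coordinates does not raise its cost. *)
Lemma mdist_class_map_le p q :
  mdist (thick_class_map p) (thick_class_map q) <= mdist p q.
Proof.
apply/ler_addgt0Pr => e e0.
have [|c [c0 cp cq] cpq] := @mdist_lt_cost _ _ _ p q (mdist p q + e).
  by rewrite ltrDl.
apply: le_trans (ltW cpq).
pose c' := push (fun z : X * X => (cl z.1, cl z.2)) c.
apply: (@le_trans _ _ (transport_cost c')).
  apply: mdist_le_cost; split; first exact: push_ge0.
    by rewrite push_comp weight_class_map -cp push_comp.
  by rewrite push_comp weight_class_map -cq push_comp.
rewrite !transport_costE fsint_push; apply: ler_fsint => // z _.
exact: mdist_orbit_class_le.
Qed.

Lemma thick_class_map_continuous : continuous thick_class_map.
Proof.
move=> p A /nbhs_ballP[e e0 eA]; apply/nbhs_ballP; exists e => // q pq.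
apply: eA; move: pq; rewrite !ballEmdist /=.
exact: le_lt_trans (mdist_class_map_le _ _).
Qed.

(* A coupling c of class_map p and q is lifted through sections of the supports.
   Its pairs at distance < eta lift isometrically, because the lift of q is
   anchored at one such pair and lifts near p are unique; the remaining pairs
   are at distance at least eta, and their lifts at distance at most 5 t. *)
Lemma thick_class_map_lift (p : thickening K) e : 0 < e ->
  exists2 d, 0 < d & forall q : thickening L, mdist (thick_class_map p) q < d ->
    exists2 q', thick_class_map q' = q & mdist p q' < e.
Proof.
move=> e0; set S := finsupp p; have KS : K S := weight_simplex p.
have [z zS] := simplex_center KS.
have [eta eta0 etaS] := finite_gap zS.
have [s scl] := simplex_section_cancel KS.
(* Near pairs need factor 1. For far pairs [5 * t] is at most [5 * t / eta] times the distance. The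
   sum covers both. *)
pose C := 1 + 5 * t / eta.
have C1 : 1 <= C by rewrite lerDl divr_ge0 ?mulr_ge0// ltW.
have C0 : 0 < C by exact: lt_le_trans C1.
exists (Num.min eta (e / C)); first by rewrite lt_min eta0 divr_gt0.
move=> q /mdist_lt_cost[c [c0 cp cq]]; rewrite lt_min => /andP[ceta ce].
have {}cp : push fst c = push cl p by exact: cp.
set T := finsupp q.
have cS y : y \in finsupp c -> exists2 x, x \in S & y.1 = cl x.
  move=> yc; have : y.1 \in finsupp (push fst c).
    by rewrite finsupp_push//; apply/imfsetP; exists y.
  by rewrite cp => /finsupp_push_sub /imfsetP[x /= xS ->]; exists x.
have cT y : y \in finsupp c -> y.2 \in T.
  move=> yc; rewrite /T -cq finsupp_push//; by apply/imfsetP; exists y.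
have c1 : fsint c (fun=> 1) = 1.
  rewrite -[RHS](weight_sum1 q) -cq sum_push; apply: eq_bigr => y _.
  by rewrite mulr1.
(* The cost is an average of distances and is below [eta], so some pair is. *)
have [[u0 v0] uvc /= uv] : exists2 y, y \in finsupp c & mdist y.1 y.2 < eta.
  apply: contrapT => far; move: ceta; rewrite ltNge => /negP; apply.
  rewrite transport_costE -[leLHS]mulr1 -c1 -fsintZ; apply: ler_fsint => // y yc.
  by rewrite mulr1 leNgt; apply/negP => yeta; apply: far; exists y.
have [x0 x0S /= u0E] := cS _ uvc; have /= v0T := cT _ uvc.
have eta_t : eta <= t by have := etaS _ x0S; have := mdist_ge0 x0 z; lra.
have [l0 l0cl Kl0] := simplex_lift (weight_simplex q).
have [|g gE] := @mdist_orbit_class_attained _ _ _ _ isom prop _ nerve x0 (l0 v0).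
  by rewrite l0cl// -u0E (lt_le_trans uv).
pose l v := a g (l0 v).
have lcl : {in T, cancel l cl}.
  by move=> v vT; rewrite /l orbit_classJ l0cl.
have Kl : K (l @` T)%fset.
  suff -> : (l @` T = a g @` (l0 @` T))%fset by exact: aK.
  apply/fsetP => x; apply/imfsetP/imfsetP => /= [[v vT ->]|[_ /imfsetP[v /= vT ->] ->]].
    by exists (l0 v) => //; apply/imfsetP; exists v.
  by exists v.
have [z' zT] := simplex_center Kl.
have {}zT v : v \in T -> mdist (l v) z' < t.
  by move=> vT; apply: zT; apply/imfsetP; exists v.
have x0l : mdist x0 (l v0) < eta by rewrite gE l0cl// -u0E.
have lip y : y \in finsupp c -> mdist (s y.1) (l y.2) <= C * mdist y.1 y.2.
  move=> yc; have [x xS ->] := cS _ yc; have := cT _ yc; move: y.2 => v vT {y yc}.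
  rewrite scl//; have [far|near] := leP eta (mdist (cl x) v).
    (* Go from [x] to [l v] through [z], [x0], [l v0] and [z']: five legs, each at most [t]. *)
    apply: (@le_trans _ _ (5 * t)).
      have := metric_triangle x z (l v); have := metric_triangle z x0 (l v).
      have := metric_triangle x0 (l v0) (l v); have := metric_triangle (l v0) z' (l v).
      have := zS _ xS; have := zS _ x0S; have := zT _ v0T; have := zT _ vT.
      rewrite (metric_sym z x0) (metric_sym z' (l v)).
      by move: x0l eta_t; lra.
    apply: (@le_trans _ _ (5 * t / eta * mdist (cl x) v)).
      have t5 : 0 <= 5 * t by rewrite mulr_ge0// ltW.
      by rewrite -mulrA ler_peMr// mulrC ler_pdivlMr// mul1r.
    by rewrite ler_wpM2r ?mdist_ge0// lerDr.
  have [|h hE] := @mdist_orbit_class_attained _ _ _ _ isom prop _ nerve x (l v).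
    by rewrite lcl// (lt_le_trans near).
  suff h1 : h = 1%g.
    by move: hE; rewrite h1 act1 lcl// => ->; rewrite ler_peMl ?mdist_ge0.
  (* [l v0] and [h (l v)] are within [eta] of the vertices [x0] and [x] of [p], so the margin [eta]
     keeps both within [t] of [z]. *)
  apply: (nerve_pair nerve (x := l v0) (y := l v) (z := z') (w := z)).
  - exact: zT.
  - exact: zT.
  - have := metric_triangle (l v0) x0 z; have := etaS _ x0S.
    by rewrite (metric_sym (l v0) x0); move: x0l; lra.
  - have := metric_triangle (a h (l v)) x z; have := etaS _ xS.
    by rewrite (metric_sym _ x) hE lcl//; move: near; lra.
have [q' q'E] := @realization_push _ _ _ _ K l q Kl.
exists (q' : thickening K).
  apply: val_inj; rewrite /= q'E push_comp push_id_in// => v; exact: lcl.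
pose c' := push (fun y : XG * XG => (s y.1, l y.2)) c.
apply: (@le_lt_trans _ _ (transport_cost c')).
  apply: mdist_le_cost; split; first exact: push_ge0.
    transitivity (push s (push fst c)); first by rewrite !push_comp.
    by rewrite cp push_comp push_id_in.
  transitivity (push l (push snd c)); first by rewrite !push_comp.
  by rewrite cq q'E.
apply: (@le_lt_trans _ _ (C * transport_cost c)).
  by rewrite !transport_costE fsint_push -fsintZ; apply: ler_fsint.
by rewrite mulrC -ltr_pdivlMr.
Qed.

Lemma thick_class_map_open U : open U -> open (thick_class_map @` U).
Proof.
rewrite !openE => oU _ [p /oU/nbhs_ballP[e e0 eU] <-].
have [d d0 dP] := thick_class_map_lift p e0.
apply/nbhs_ballP; exists d => // q; rewrite ballEmdist => /dP[q' q'q pq'].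
by exists q' => //; apply: eU; rewrite ballEmdist.
Qed.

Lemma orbit_thickening_homeomorphic :
  homeomorphic (thickening L)
    (orbit_space (induced_action R aK : group_action G (thickening K))).
Proof.
have [|f fhom _] := @orbit_homeomorphism _ (thickening K) (thickening L)
  (induced_action R aK) _ thick_class_map_continuous class_map_fiber class_map_surj.
  by move=> U oU _; exact: thick_class_map_open.
by exists f.
Qed.

End OrbitNerve.

(** * The strict and non-strict cases *)

Theorem proposition3p6 (R : realType) (G : groupType) (X : metricType R)
    (a : group_action G X) (isom : isometric_action a) (prop : proper_action a)
    (t : R) (t0 : 0 < t) (nerve : nerve_action isom prop t) :
  [/\ forall r : R, 0 <= r <= t ->
        simplicial_isomorphic
          (realization_structure R (cech_lt (metric_orbit_space isom prop) r))
          (orbit_structure (cech_lt_action isom r)),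
      forall r : R, 0 <= r < t ->
        simplicial_isomorphic
          (realization_structure R (cech_le (metric_orbit_space isom prop) r))
          (orbit_structure (cech_le_action isom r)),
      forall r : R, 0 <= r <= t ->
        homeomorphic
          (thickening (cech_lt (metric_orbit_space isom prop) r))
          (orbit_space (cech_lt_thickening_action isom r))
    & forall r : R, 0 <= r < t ->
        homeomorphic
          (thickening (cech_le (metric_orbit_space isom prop) r))
          (orbit_space (cech_le_thickening_action isom r))].
Proof.
have ltE (Y : metricType R) r (S : {fset Y}) : cech_lt Y r S <->
    S != fset0 /\ exists z, forall x, x \in S -> mdist x z < r.
  split=> -[S0 [z zS]]; split=> //; exists z => x /zS; by rewrite ballEmdist.
have leE (Y : metricType R) r (S : {fset Y}) : cech_le Y r S <->
    S != fset0 /\ exists z, forall x, x \in S -> mdist x z <= r.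
  by split=> -[S0 [z zS]]; split=> //; exists z => x /zS.
have lt_le (r d e : R) : d <= e -> e < r -> d < r by exact: le_lt_trans.
have le_le (r d e : R) : d <= e -> e <= r -> d <= r by exact: le_trans.
split=> r /andP[_ rt].
- apply: (orbit_realization_isomorphic nerve (close := fun d => d < r)) => //.
    by move=> d /lt_le_trans; apply.
  exact: lt_le.
- apply: (orbit_realization_isomorphic nerve (close := fun d => d <= r)) => //.
    by move=> d /le_lt_trans; apply.
  exact: le_le.
- apply: (orbit_thickening_homeomorphic t0 nerve (close := fun d => d < r)) => //.
    by move=> d /lt_le_trans; apply.
  exact: lt_le.
- apply: (orbit_thickening_homeomorphic t0 nerve (close := fun d => d <= r)) => //.
    by move=> d /le_lt_trans; apply.
  exact: le_le.
Qed.
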